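(* Let $\boldsymbol\mu:[0,T]\to\mathcal P(\Omega\times\mathbb R^d)$ be a Borel curve that is a distributional solution of $$\partial_t\boldsymbol\mu(t)+\mathrm{div}_x(\mathbf v(t)\boldsymbol\mu(t))=0$$ and satisfies $$\int_0^T\int_{\Omega\times\mathbb R^d}\frac{|\mathbf v(t,\omega,x)|}{1+|x|}\,d\boldsymbol\mu(t)(\omega,x)\,dt<+\infty.$$ Then its first marginal $t\in[0,T]\mapsto(\mathfrak p_\Omega)_\sharp\boldsymbol\mu(t)\in\mathcal P(\Omega)$ is constant, where $\mathfrak p_\Omega:\Omega\times\mathbb R^d\to\Omega$ is the projection.
   Context: $(\Omega,\mathcal A,\pi)$ is a complete probability space over a Polish space $\Omega$, $T>0$, and $\mathcal P(\cdot)$ denotes Borel probability measures with the narrow topology. The vector field $\mathbf v:[0,T]\times\Omega\times\mathbb R^d\to\mathbb R^d$ is Lebesgue-Borel, i.e. $\mathcal L^1\times\pi$-measurable in $(t,\omega)\in[0,T]\times\Omega$ and Borel in $x\in\mathbb R^d$. The set $\mathrm{Adm}((0,T)\times\Omega\times\mathbb R^d)$ of admissible test functions consists of all $\phi\in C^0_b([0,T]\times\Omega\times\mathbb R^d,\mathbb R)$ such that $\phi(\cdot,\omega,\cdot)\in C^1_c((0,T)\times\mathbb R^d)$ for all $\omega\in\Omega$ and $\sup_{\omega\in\Omega}\|\phi(\cdot,\omega,\cdot)\|_{C^1([0,T]\times\mathbb R^d,\mathbb R)}<+\infty$. A Borel curve $\boldsymbol\mu:[0,T]\to\mathcal P(\Omega\times\mathbb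 R^d)$ is a distributional solution if $$\int_0^T\int_{\Omega\times\mathbb R^d}\big(\partial_t\phi(t,\omega,x)+\langle\nabla_x\phi(t,\omega,x),\mathbf v(t,\omega,x)\rangle\big)\,d\boldsymbol\mu(t)(\omega,x)\,dt=0$$ for every $\phi\in\mathrm{Adm}((0,T)\times\Omega\times\mathbb R^d)$.
   Formalization: The first marginal is shown to equal one fixed probability measure for almost every t in [0,T], not for every t: a Borel curve may be changed at a single time without affecting the equation or the growth bound, so the claim for every t is false. *)

(* Defs.v *)
From HB Require Import structures.
From mathcomp Require Export all_boot all_order all_algebra.
From mathcomp Require Export all_classical all_reals all_analysis measurable_realfun.
Export numFieldNormedType.Exports.

Set Implicit Arguments.
Unset Strict Implicit.
Unset Printing Implicit Defensive.

Import Order.TTheory GRing.Theory Num.Theory.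

Local Open Scope classical_set_scope.
Local Open Scope ring_scope.

(* A Polish space is a completeMetricType that is separable.  Everything below
   depends on the topology only, so quantifying over all complete metrics is the
   same as quantifying over completely metrizable topologies.  The base point
   required by the hierarchy is harmless, as the spaces carry probabilities. *)
#[short(type="completeMetricType")]
HB.structure Definition CompleteMetric (R : numDomainType) :=
  { M of Metric R M & CompletePseudoMetric R M }.

(* The join of the pointed and topological structures on products. *)
HB.instance Definition _ (X Y : ptopologicalType) := Pointed.on (X * Y)%type.

Definition separable (X : topologicalType) : Prop :=
  exists2 D : set X, countable D & dense D.

Definition borel (X : ptopologicalType) : measurableType (@open X).-sigma :=
  g_sigma_algebraType (@open X).

Section NarrowTopology.
Context (R : realType) (X : ptopologicalType).

Definition bounded_continuous : Type :=
  {f : X -> R | continuous f /\ exists M : R, forall x, `|f x| <= M}.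

Definition narrow_eval (P : probability (borel X) R) :
    {ptws bounded_continuous -> R} :=
  fun f => \int[P]_x sval f x.

Definition narrow := initial_topology narrow_eval.

Definition Borel_curve (T : R) (mu : R -> probability (borel X) R) : Prop :=
  measurable_fun `[0, T] (mu : R -> borel narrow).

End NarrowTopology.

Section Euclidean.
Context (R : realType) (d : nat).

(* The library norm of 'rV[R]_d is the maximum norm. *)
Definition dotr (x y : 'rV[R]_d) : R := \sum_(i < d) x 0 i * y 0 i.

Definition enorm (x : 'rV[R]_d) : R := Num.sqrt (dotr x x).

Definition dt (f : R * 'rV[R]_d -> R) (z : R * 'rV[R]_d) : R :=
  derive1 (fun s => f (s, z.2)) z.1.

Definition gradx (f : R * 'rV[R]_d -> R) (z : R * 'rV[R]_d) : 'rV[R]_d :=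
  \row_(i < d) 'D_(delta_mx 0 i) (fun y => f (z.1, y)) z.2.

(* Functions of time are total on R; only their values for t in [0, T] matter. *)
Definition C1c (T : R) (f : R * 'rV[R]_d -> R) : Prop :=
  (forall z : R * 'rV[R]_d, z.1 \in `]0, T[ ->
     differentiable f z /\
     forall h : R * 'rV[R]_d, {for z, continuous (fun y => 'd f y h)}) /\
  exists K : set (R * 'rV[R]_d),
    [/\ compact K, (forall z, K z -> z.1 \in `]0, T[) &
        forall z : R * 'rV[R]_d, z.1 \in `[0, T] -> f z != 0 -> K z].

(* For f in C1c T the suprema over ]0, T[ and over [0, T] agree. *)
Definition C1norm (T : R) (f : R * 'rV[R]_d -> R) : \bar R :=
  let U := [set z : R * 'rV[R]_d | z.1 \in `]0, T[] in
  (ereal_sup [set `|f z|%:E | z in U] + ereal_sup [set `|dt f z|%:E | z in U]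
   + ereal_sup [set (enorm (gradx f z))%:E | z in U])%E.

End Euclidean.

Section ContinuityEquation.
Context (R : realType) (Omega : completeMetricType R) (d : nat) (T : R).

Let state : ptopologicalType := (Omega * 'rV[R]_d)%type.

Definition slice (phi : R * Omega * 'rV[R]_d -> R) (w : Omega) :
    R * 'rV[R]_d -> R :=
  fun z => phi (z.1, w, z.2).

Definition Adm (phi : R * Omega * 'rV[R]_d -> R) : Prop :=
  [/\ {within [set z : R * Omega * 'rV[R]_d | z.1.1 \in `[0, T]], continuous phi},
      exists M : R, forall z : R * Omega * 'rV[R]_d,
        z.1.1 \in `[0, T] -> `|phi z| <= M,
      forall w, C1c T (slice phi w) &
      (ereal_sup [set C1norm T (slice phi w) | w in [set: Omega]] < +oo)%E].

(* L^1 x pi-measurability is measurability for the completion of the product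
   sigma-algebra; A is the sigma-algebra of the probability space. *)
Definition completed_time_sample (A : set (set Omega))
    (pi : probability (g_sigma_algebraType A) R) : measurableType _ :=
  g_sigma_algebraType (completed_algebra_gen (lebesgue_measure \x pi)%E).

Definition Lebesgue_Borel (A : set (set Omega))
    (pi : probability (g_sigma_algebraType A) R)
    (v : R * Omega * 'rV[R]_d -> 'rV[R]_d) : Prop :=
  @measurable_fun _ _ (completed_time_sample pi * borel 'rV[R]_d)%type
    (borel 'rV[R]_d) [set z : R * Omega * 'rV[R]_d | z.1.1 \in `[0, T]] v.

(* Lebesgue integrability for the measure mu(t)(dz) dt on [0, T] x (Omega x R^d).
   Its first half is measurability for the completion of that measure: f need
   not be Borel, because v is not. *)
Definition integrable_along (mu : R -> probability (borel state) R)
    (f : R -> state -> R) : Prop :=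
  (exists2 g : R * borel state -> R, measurable_fun setT g &
     {ae lebesgue_measure, forall t : R, t \in `[0, T] ->
       {ae mu t, forall z, f t z = g (t, z)}}) /\
  (\int[lebesgue_measure]_(t in `[0%R, T]) \int[mu t]_z `|f t z|%:E < +oo)%E.

Definition pairing (phi : R * Omega * 'rV[R]_d -> R)
    (v : R * Omega * 'rV[R]_d -> 'rV[R]_d) (t : R) (z : state) : R :=
  dt (slice phi z.1) (t, z.2)
  + dotr (gradx (slice phi z.1) (t, z.2)) (v (t, z.1, z.2)).

Definition distributional_solution (v : R * Omega * 'rV[R]_d -> 'rV[R]_d)
    (mu : R -> probability (borel state) R) : Prop :=
  forall phi, Adm phi ->
    integrable_along mu (pairing phi v) /\
    (\int[lebesgue_measure]_(t in `[0%R, T])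
       \int[mu t]_z (pairing phi v t z)%:E = 0)%E.

End ContinuityEquation.

(* Main.v *)
(** Test the equation with [eta(t) psi(w) chi_n(x)], where [chi_n] is the
    logarithmic cutoff [max(0, 1 - ln(1 + |x|^2) / (n + 1))^2].  Since
    [|grad chi_n| (1 + |x|) <= 8 / (n + 1)], the growth bound makes the flux term
    vanish as [n] tends to infinity, and [eta'] integrates to zero against
    [t |-> g t], the integral of [psi] for the first marginal at time [t].  Taking for
    [eta'] the difference of two tents of width [e] around Lebesgue points [a] and
    [b] of [g], and letting [e] tend to [0], gives [g a = g b].  Countably many
    [psi], approximating the indicators of a countable pi-system of open sets, then
    determine the marginals for almost all times simultaneously. *)

From HB Require Import structures.
Require Import Defs.
From mathcomp Require Import ring lra.

Set Implicit Arguments.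
Unset Strict Implicit.
Unset Printing Implicit Defensive.

Import Order.TTheory GRing.Theory Num.Theory.

Local Open Scope classical_set_scope.
Local Open Scope ring_scope.

(** * Lower integrals *)

(** The field [v] need not be Borel, so for a fixed [t] the pairing is at best almost everywhere
    equal to a Borel function, and additivity of its integral is not freely available. The flux is
    therefore never integrated alone: the whole pairing is bounded above by a measurable majorant,
    which gives an inequality with an error of order [1 / (n + 1)], and replacing [psi] by [- psi]
    gives the opposite one. The logarithm serves this purpose. A cutoff [chi (x / n)] would only
    keep [|grad chi_n| (1 + |x|)] bounded, leaving a dominated convergence argument on integrands
    that contain [v]; the logarithmic cutoff yields an explicit uniform rate instead. Using [|x|^2]
    keeps it smooth at the origin, and squaring the positive part makes it C^1 with compact support.
    The conclusion concerns almost every time, because modifying [mu] on a Borel null set of times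
    changes neither the equation nor the growth bound. *)

Section lower_integral.
Context d (X : measurableType d) (R : realType).
Variable mu : {measure set X -> \bar R}.
Local Open Scope ereal_scope.
Import HBNNSimple.

(** A simple function below [f], multiplied by the indicator of the complement of [N], falls below
    [g] everywhere and keeps its integral. *)
Lemma ge0_lower_integral_le (f g : X -> \bar R) (N : set X) :
  measurable N -> mu N = 0 -> (forall x, 0 <= f x) -> (forall x, 0 <= g x) ->
  (forall x, ~ N x -> f x <= g x) -> \int[mu]_x f x <= \int[mu]_x g x.
Proof.
move=> mN N0 f0 g0 fg.
rewrite ge0_integralTE// [leRHS]ge0_integralTE//.
apply: ge_ereal_sup => _ [h hf <-].
pose h' := mul_nnsfun h (indic_nnsfun R (measurableC mN)).
have -> : sintegral mu h = sintegral mu h'.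
  rewrite -!integralT_nnsfun; apply: ge0_ae_eq_integral => //.
  - exact/measurable_EFinP.
  - exact/measurable_EFinP.
  - by move=> x _; rewrite lee_fin.
  - by move=> x _; rewrite lee_fin.
  exists N; split => // x /= hx; apply: contrapT => Nx; apply: hx => _ /=.
  by rewrite mindicE mem_set ?mulr1.
apply: ereal_sup_ubound; exists h' => // x /=.
have [xN|xN] := pselect (N x).
  by rewrite mindicE memNset ?mulr0// => /(_ xN).
by rewrite mindicE mem_set// mulr1 (le_trans (hf x))// fg.
Qed.

(* No measurability is needed: the library integral of an arbitrary function is
   the difference of the lower integrals of its positive and negative parts.
   This matters because [v] is not assumed to be Borel. *)
Lemma lower_integral_le (D : set X) (f g : X -> \bar R) :
  {ae mu, forall x, D x -> f x <= g x} ->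
  \int[mu]_(x in D) f x <= \int[mu]_(x in D) g x.
Proof.
move=> [N [mN N0 fgN]].
have fg x : ~ N x -> (f \_ D) x <= (g \_ D) x.
  move=> Nx; rewrite !patchE; case: ifPn => // /set_mem Dx.
  by apply: contrapT => h; apply: Nx; apply: fgN => /= /(_ Dx).
rewrite integral_mkcond [leRHS]integral_mkcond integralE [leRHS]integralE.
apply: leeB; apply: (ge0_lower_integral_le mN) => // x Nx.
- by rewrite !funeposE ge_max !le_max lexx orbT andbT fg.
- by rewrite !funenegE ge_max !le_max lexx orbT andbT leeN2 fg.
Qed.

End lower_integral.

(** * Narrow topology and Borel curves *)

Section open_approximation.
Context (R : realType).

(** The set [B n] of points whose ball of radius [1 / (n + 1)] stays in [U] is uniformly separated
    from the complement of [U], so a Urysohn function is 0 off [U] and 1 on [B n]. Each point of [U]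
    lies in [B n] for all large [n], hence the sequence is eventually constant at every point. *)
Lemma open_indic_cvg (X : pseudoMetricType R) (U : set X) : open U ->
  exists f : nat -> X -> R, [/\ forall n, continuous (f n),
    forall n x, 0 <= f n x <= 1 &
    forall x, f n x @[n --> \oo] --> (\1_U x : R)].
Proof.
move=> oU.
pose B n := [set x | ball x (n.+1%:R^-1 : R) `<=` U].
have sep n : uniform_separator (~` U) (B n).
  apply: uniform_separatorW.
  exists [set xy | ball xy.1 (n.+1%:R^-1 : R) xy.2].
    exact: entourage_ball (PosNum _).
  rewrite -subset0 => -[x y] /= [[Ux By]] xy; apply: Ux; apply: By.
  exact: ball_sym.
exists (fun n => Urysohn (~` U) (B n)); split.
- by move=> n; exact: Urysohn_continuous.
- move=> n x; have /= := @Urysohn_range _ R (~` U) (B n).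
  by move=> /(_ (Urysohn (~` U) (B n) x)) /=; rewrite in_itv /=; apply; exists x.
move=> x; have [Ux|Ux] := pselect (U x); last first.
  apply: (@cvg_trans _ ((fun=> \1_U x : R) @ \oo)); last exact: cvg_cst.
  apply: near_eq_cvg; apply: nearW => n /=; rewrite indicE memNset//.
  by apply/esym; apply: (@Urysohn_sub0 _ R _ _ (sep n)); exists x.
have /nbhs_ballP[e /= e0 eU] : nbhs x U by apply: open_nbhs_nbhs.
apply: (@cvg_trans _ ((fun=> \1_U x : R) @ \oo)); last exact: cvg_cst.
apply: near_eq_cvg; near=> n; rewrite indicE mem_set//.
apply/esym; apply: (@Urysohn_sub1 _ R _ _ (sep n)); exists x => //.
apply: subset_trans eU; apply: le_ball.
near: n; have := @near_infty_natSinv_lt R (PosNum e0).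
by apply: filterS => n /ltW.
Unshelve. all: by end_near. Qed.

End open_approximation.

Lemma bounded_cvg_RintegralD (R : realType) d (X : measurableType d)
    (mu : {measure set X -> \bar R}) (D : set X) (f : nat -> X -> R) (g : X -> R)
    (M : R) :
  measurable D -> (mu D < +oo)%E ->
  (forall n, measurable_fun D (f n)) -> (forall n x, D x -> `|f n x| <= M) ->
  (forall x, D x -> f n x @[n --> \oo] --> g x) ->
  \int[mu]_(x in D) f n x @[n --> \oo] --> \int[mu]_(x in D) g x.
Proof.
move=> mD Doo mf fM fg.
have mg : measurable_fun D g by exact: (measurable_fun_cvg mf).
have [|||||ig _ h] := @dominated_convergence _ X R mu D mD
  (fun n x => (f n x)%:E) (fun x => (g x)%:E) (fun=> M%:E).
- by move=> n; exact/measurable_EFinP.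
- exact/measurable_EFinP.
- by apply: aeW => x Dx; apply/fine_cvgP; split; [exact: nearW|exact: fg].
- apply: measurable_bounded_integrable => //; exists `|M|; split => //.
  by move=> r Mr x _; exact: ltW.
- by apply: aeW => x n Dx; exact: fM.
have fi n : (\int[mu]_(x in D) (f n x)%:E)%E \is a fin_num.
  apply: integrable_fin_num => //.
  apply: measurable_bounded_integrable => //; exists `|M|; split => //.
  by move=> r Mr x Dx; apply: le_trans (fM n x Dx) (le_trans (ler_norm M) (ltW Mr)).
apply: fine_cvg; rewrite fineK //.
exact: integrable_fin_num.
Qed.

Section borel_space.
Context (R : realType) (X : ptopologicalType).

Lemma continuous_borel_measurable (f : X -> R) : continuous f ->
  measurable_fun [set: borel X] (f : borel X -> R).
Proof.
move=> cf; apply: (measurability _ (RGenOpens.measurableE R)).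
move=> _ [_ [a [b ->] <-]]; rewrite setTI.
apply: sub_sigma_algebra.
by apply: open_comp; [move=> x _; exact: cf|exact: interval_open].
Qed.

Lemma bounded_continuous_integrable (P : probability (borel X) R) (f : X -> R)
    (M : R) : continuous f -> (forall x, `|f x| <= M) ->
  P.-integrable setT (EFin \o f).
Proof.
move=> cf fM; apply: measurable_bounded_integrable => //.
- by rewrite -ge0_fin_numE// (fin_num_measure P).
- exact: continuous_borel_measurable.
- exists M; split; first exact: num_real.
  by move=> r Mr x _ /=; apply: le_trans (fM x) (ltW Mr).
Qed.

Lemma normr_Rintegral_le (P : probability (borel X) R) (f : X -> R) (M : R) :
  continuous f -> (forall x, `|f x| <= M) -> `|\int[P]_x f x| <= M.
Proof.
move=> cf fM; have fi := bounded_continuous_integrable P cf fM.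
apply: le_trans (le_normr_Rintegral measurableT fi) _.
have -> : M = \int[P]_(x in setT) (fun=> M) x.
  rewrite Rintegral_cst//; have -> : fine (P setT) = 1 by rewrite [P setT]probability_setT.
  by rewrite mulr1.
apply: le_Rintegral => //.
- exact: integrable_norm.
- exact: finite_measure_integrable_cst.
Qed.

Lemma bounded_cvg_Rintegral (P : probability (borel X) R) (f : nat -> X -> R)
    (g : X -> R) (M : R) :
  (forall n, continuous (f n)) -> (forall n x, `|f n x| <= M) ->
  (forall x, f n x @[n --> \oo] --> g x) ->
  \int[P]_x f n x @[n --> \oo] --> \int[P]_x g x.
Proof.
move=> cf fM fg; apply: (@bounded_cvg_RintegralD _ _ _ P setT f g M) => //.
- by rewrite -ge0_fin_numE// (fin_num_measure P).
- by move=> n; exact: continuous_borel_measurable.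
Qed.

(** This is the only consequence of metrizability that the measurability of curves requires; it lets
    the space remain a bare topological one until [open_indic_cvg] supplies the approximations. *)
Definition approximable_opens : Prop := forall U : set X, open U ->
  exists f : nat -> X -> R, [/\ forall n, continuous (f n),
    forall n x, 0 <= f n x <= 1 &
    forall x, f n x @[n --> \oo] --> (\1_U x : R)].

Lemma open_probability_cvg (P : probability (borel X) R) (U : set X)
    (f : nat -> X -> R) : open U ->
  (forall n, continuous (f n)) -> (forall n x, 0 <= f n x <= 1) ->
  (forall x, f n x @[n --> \oo] --> (\1_U x : R)) ->
  (\int[P]_x f n x)%:E @[n --> \oo] --> P U.
Proof.
move=> oU cf f01 fU.
have mU : measurable (U : set (borel X)) by exact: sub_sigma_algebra.
have -> : P U = (\int[P]_x \1_U x)%:E.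
  rewrite /Rintegral fineK; last by apply: integrable_fin_num => //; exact: integrable_indic.
  by rewrite integral_indic// setIT.
apply/cvg_EFin; first exact: nearW.
apply: (@bounded_cvg_Rintegral P f _ 1) => // n x.
by have /andP[f0 f1] := f01 n x; rewrite ger0_norm.
Qed.

End borel_space.

Section borel_curve.
Context (R : realType) (X : ptopologicalType) (T : R).
Variable mu : R -> probability (borel X) R.
Hypothesis mmu : Borel_curve T mu.

(** Evaluation at [f] is one of the coordinates that define the narrow topology, so it is
    continuous, hence Borel, and can be composed with the curve. *)
Lemma Borel_curve_integral (f : X -> R) (M : R) :
  continuous f -> (forall x, `|f x| <= M) ->
  measurable_fun `[0, T] (fun t => \int[mu t]_x f x).
Proof.
move=> cf fM.
pose F : bounded_continuous R X :=
  exist _ f (conj cf (ex_intro (fun M => forall x, `|f x| <= M) M fM)).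
pose ev (P : narrow R X) : R := @narrow_eval R X P F.
have cev : continuous ev.
  move=> P; apply: (@cvg_comp _ _ _ (@narrow_eval R X) (fun h => h F) _
    (nbhs (@narrow_eval R X P : {ptws bounded_continuous R X -> R}))).
    exact: (@initial_continuous _ _ (@narrow_eval R X)).
  set p : {ptws bounded_continuous R X -> R} := narrow_eval P.
  (* The pointwise topology is the supremum of the initial topologies of the evaluations; the one at
     [F] is extracted here. *)
  have /cvg_sup/(_ F) pF : nbhs p --> p by exact: cvg_id.
  apply: cvg_trans (@initial_continuous _ _ (fun h : bounded_continuous R X -> R => h F) p).
  exact: cvg_app pF.
apply: (@measurableT_comp _ _ _ _ _ _ (ev : borel (narrow R X) -> R)); last exact: mmu.
exact: continuous_borel_measurable.
Qed.

Hypothesis appr : approximable_opens R X.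

(** Open sets form a pi-system, and on them [mu t U] is a limit of integrals of continuous
    functions; Dynkin induction extends this to all Borel sets. *)
Lemma Borel_curve_measurable (U : set (borel X)) : measurable U ->
  measurable_fun `[0, T] (fun t => mu t U).
Proof.
move: U; apply: (@dynkin_induction _ (borel X) (@open X)) => //.
- by move=> A B; exact: openI.
- by apply: (eq_measurable_fun (fun=> 1%E)) => // t _; rewrite probability_setT.
- move=> U oU; have [f [cf f01 fU]] := appr oU.
  apply: (emeasurable_fun_cvg (fun n t => (\int[mu t]_x f n x)%:E)) => //.
    move=> n; apply/measurable_EFinP.
    apply: (@Borel_curve_integral _ 1) => // x.
    by have /andP[f0 f1] := f01 n x; rewrite ger0_norm.
  by move=> t _; exact: (@open_probability_cvg _ _ (mu t) U f).
- move=> S mS mf; apply: (eq_measurable_fun (fun t => 1 - mu t S)%E).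
    by move=> t _; rewrite probability_setC.
  exact: emeasurable_funB.
- move=> F mF tF mf.
  apply: (eq_measurable_fun (fun t => \sum_(n <oo | n \in xpredT) mu t (F n))%E).
    move=> t _ /=; rewrite measure_bigcup//.
    by apply: eq_eseriesl => i; rewrite in_setT.
  exact: ge0_emeasurable_sum.
Qed.

(** Extending the curve by the constant value [mu 0] outside the segment makes it a probability
    kernel on all of [R], to which measurability of parametric integrals applies. *)
Definition curve_kernel (t : R) : {measure set (borel X) -> \bar R} :=
  if t \in `[0, T] then mu t else mu 0.

Let measurable_curve_kernel (U : set (borel X)) : measurable U ->
  measurable_fun [set: R] (curve_kernel ^~ U).
Proof.
move=> mU; rewrite [X in measurable_fun _ X](_ : _ =
    fun t => if t \in `[0, T] then mu t U else mu 0 U); last first.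
  by apply/funext => t; rewrite /curve_kernel; case: ifP.
have mI : measurable (`[0, T]%classic : set R) by exact: measurable_itv.
apply: measurable_fun_if => //.
- by apply: (measurable_fun_bool true); rewrite setTI.
- by rewrite setTI; exact: Borel_curve_measurable.
Qed.

HB.instance Definition _ :=
  isKernel.Build _ _ R (borel X) R curve_kernel measurable_curve_kernel.

Let curve_kernel_prob t : curve_kernel t [set: borel X] = 1%E.
Proof. by rewrite /curve_kernel; case: ifP => _; exact: probability_setT. Qed.

HB.instance Definition _ :=
  Kernel_isProbability.Build _ _ R (borel X) R curve_kernel curve_kernel_prob.

Lemma Borel_curve_integral_measurable (k : R * borel X -> \bar R) :
  (forall z, 0 <= k z)%E -> measurable_fun setT k ->
  measurable_fun `[0, T] (fun t => \int[mu t]_z k (t, z))%E.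
Proof.
move=> k0 mk.
apply: (eq_measurable_fun (fun t => \int[curve_kernel t]_z k (t, z))%E).
  by move=> t /set_mem /= tT; rewrite /curve_kernel tT.
have h := measurable_fun_integral_finite_kernel k curve_kernel k0 mk.
exact: (measurable_funS measurableT (@subsetT _ _) h).
Qed.

End borel_curve.

(** * Calculus *)

Section differentials.
Context (R : realType).

(** A second-order error bound treats piecewise quadratic functions uniformly, with no separate
    discussion at the points where the pieces meet. *)
Lemma is_derive_quadratic (f : R -> R) (C x l : R) : 0 < C ->
  (forall h, `|f (x + h) - f x - l * h| <= C * h ^+ 2) -> is_derive x 1 f l.
Proof.
move=> C0 fq.
have lim : (fun h => h^-1 *: (f (h *: 1 + x) - f x)) @ 0^' --> l.
  apply/cvgrPdist_le => e e0; near=> h.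
  have h0 : h != 0 by near: h; exact: nbhs_dnbhs_neq.
  have hn : 0 < `|h| by rewrite normr_gt0.
  have he : `|h| <= e / C.
    near: h; apply: dnbhs0_le; exact: divr_gt0.
  rewrite /GRing.scale /= mulr1 (addrC h).
  have -> : l - h^-1 * (f (x + h) - f x) = - h^-1 * (f (x + h) - f x - l * h).
    by field.
  rewrite normrM normrN normfV ler_pdivrMl//.
  apply: le_trans (fq h) _; rewrite -real_normK ?num_real// expr2 mulrCA.
  by rewrite ler_wpM2l// -ler_pdivlMl// mulrC.
apply: DeriveDef; first by apply/cvg_ex; exists l.
exact: cvg_lim lim.
Unshelve. all: by end_near. Qed.

Lemma is_derive_is_diff (f : R -> R) (x l : R) :
  is_derive x 1 f l -> is_diff x f (fun h => h * l).
Proof.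
move=> [df fl]; have df' : differentiable f x by exact/derivable1_diffP.
by apply: DiffDef => //; rewrite diff1E// derive1E fl.
Qed.

Lemma is_diff_sum (V : normedModType R) n (f df : 'I_n -> V -> R) (x : V) :
  (forall i, is_diff x (f i) (df i)) ->
  is_diff x (fun y => \sum_(i < n) f i y) (fun h => \sum_(i < n) df i h).
Proof.
elim: n f df => [|n IH] f df H.
  rewrite [X in is_diff _ X _](_ : _ = cst 0); last by apply/funext => y; rewrite big_ord0.
  rewrite [X in is_diff _ _ X](_ : _ = 0); last by apply/funext => y; rewrite big_ord0.
  exact: is_diff_cst.
rewrite [X in is_diff _ X _](_ : _ = (fun y => \sum_(i < n) f (widen_ord (leqnSn n) i) y) + f ord_max); last first.
  by apply/funext => y; rewrite big_ord_recr.
rewrite [X in is_diff _ _ X](_ : _ = (fun y => \sum_(i < n) df (widen_ord (leqnSn n) i) y) + df ord_max); last first.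
  by apply/funext => y; rewrite big_ord_recr.
by apply: is_diffD; exact: IH.
Qed.

Lemma is_diff_coord d (x : 'rV[R]_d) (i : 'I_d) :
  is_diff x (fun y : 'rV[R]_d => y 0 i) (fun h => h 0 i).
Proof.
(* Seen as a continuous linear map, the coordinate is its own differential. *)
have @f : {linear 'rV[R]_d -> R}.
  by exists (fun N : 'rV[R]_d => N 0 i); do 2![eexists]; do ?[constructor];
     rewrite ?mxE// => ? *; rewrite ?mxE//; move=> ?; rewrite !mxE.
have cf : continuous f by move=> y; exact: coord_continuous.
have -> : (fun y : 'rV[R]_d => y 0 i) = f by [].
apply: DiffDef; first exact/linear_differentiable/cf.
by rewrite diff_lin.
Qed.

Lemma is_diff_dotr d (x : 'rV[R]_d) :
  is_diff x (fun y => dotr y y) (fun h => 2 * dotr x h).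
Proof.
have H i := is_diffM (is_diff_coord x i) (is_diff_coord x i).
have := is_diff_sum H.
rewrite [X in is_diff _ _ X -> _](_ : _ = (fun h => 2 * dotr x h)) //.
apply/funext => h /=; rewrite mulr_sumr; apply: eq_bigr => i _.
by rewrite !fctE /GRing.scale /=; ring.
Qed.

Lemma continuous_dotr d (T : topologicalType) (f g : T -> 'rV[R]_d) :
  continuous f -> continuous g -> continuous (fun x => dotr (f x) (g x)).
Proof.
move=> cf cg x.
apply: cvg_big => [|i _]; first by move=> z; exact: add_continuous.
apply: cvgM.
  exact: (@continuous_comp _ _ _ f (fun v : 'rV[R]_d => v 0 i) x (cf x) (@coord_continuous _ _ _ _ _ _)).
exact: (@continuous_comp _ _ _ g (fun v : 'rV[R]_d => v 0 i) x (cg x) (@coord_continuous _ _ _ _ _ _)).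
Qed.

Lemma dotrZl d (a : R) (x y : 'rV[R]_d) : dotr (a *: x) y = a * dotr x y.
Proof. by rewrite /dotr mulr_sumr; apply: eq_bigr => i _; rewrite mxE mulrA. Qed.

Lemma dotrr_ge0 d (x : 'rV[R]_d) : 0 <= dotr x x.
Proof. by apply: sumr_ge0 => i _; rewrite -expr2 sqr_ge0. Qed.

Lemma enorm_ge0 d (x : 'rV[R]_d) : 0 <= enorm x.
Proof. exact: sqrtr_ge0. Qed.

Lemma enorm_sq d (x : 'rV[R]_d) : enorm x ^+ 2 = dotr x x.
Proof. by rewrite sqr_sqrtr// dotrr_ge0. Qed.

Lemma enormZ d (a : R) (x : 'rV[R]_d) : enorm (a *: x) = `|a| * enorm x.
Proof.
rewrite /enorm (_ : dotr _ _ = a ^+ 2 * dotr x x).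
  by rewrite sqrtrM ?sqr_ge0// sqrtr_sqr.
by rewrite /dotr mulr_sumr; apply: eq_bigr => i _; rewrite !mxE; ring.
Qed.

Lemma sqr_coord_le d (x : 'rV[R]_d) i : (x 0 i) ^+ 2 <= dotr x x.
Proof.
rewrite /dotr (bigD1 i)//= -expr2 lerDl; apply: sumr_ge0 => j _.
by rewrite -expr2 sqr_ge0.
Qed.

(** Cauchy-Schwarz: with [u], [v] the two norms, the squared norm of [s x + t y] is nonnegative at
    [(v, u)] and [(v, - u)], which suffices if [u * v] is positive. The degenerate case needs other
    parameters. *)
Lemma normr_dotr d (x y : 'rV[R]_d) : `|dotr x y| <= enorm x * enorm y.
Proof.
have key (s t : R) : 0 <= s ^+ 2 * dotr x x + 2 * s * t * dotr x y + t ^+ 2 * dotr y y.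
  rewrite (_ : _ + _ = dotr (s *: x + t *: y) (s *: x + t *: y)) ?dotrr_ge0//.
  rewrite /dotr !mulr_sumr -!big_split; apply: eq_bigr => i _ /=.
  by rewrite !mxE; ring.
have x0 := enorm_ge0 x; have y0 := enorm_ge0 y.
move: key; rewrite -!enorm_sq; move: (dotr x y) => b.
move: (enorm x) (enorm y) x0 y0 => u v u0 v0 key.
have [xy0|xy0] := eqVneq (u * v) 0; last first.
  have uv : 0 < u * v by rewrite lt_def xy0 mulr_ge0.
  rewrite ler_norml; apply/andP; split.
    have := key v u => h; have := mulr_gt0 uv uv; nra.
  have := key v (- u) => h; nra.
rewrite xy0 normr_le0; move/eqP: xy0; rewrite mulf_eq0 => /orP[]/eqP z.
  (* With [u = 0] the form is [2 s t b + t^2 v^2]; this choice of [s] and [t] turns it into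
     [- b^4 (v^2 + 2)], so [b] must vanish. The case [v = 0] is symmetric. *)
  have := key (- b * (v ^+ 2 + 1)) (b ^+ 2); rewrite z.
  have -> : (- b * (v ^+ 2 + 1)) ^+ 2 * 0 ^+ 2 + 2 * (- b * (v ^+ 2 + 1)) * b ^+ 2 * b
     + (b ^+ 2) ^+ 2 * v ^+ 2 = - (b ^+ 4 * (v ^+ 2 + 2)) by ring.
  rewrite oppr_ge0 pmulr_lle0; last by rewrite ltr_wpDl// sqr_ge0.
  move=> b4; suff : b ^+ 4 == 0 by rewrite expf_eq0.
  by rewrite eq_le b4 -[4%N]/(2 * 2)%N exprM sqr_ge0.
have := key (b ^+ 2) (- b * (u ^+ 2 + 1)); rewrite z.
have -> : (b ^+ 2) ^+ 2 * u ^+ 2 + 2 * b ^+ 2 * (- b * (u ^+ 2 + 1)) * b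
     + (- b * (u ^+ 2 + 1)) ^+ 2 * 0 ^+ 2 = - (b ^+ 4 * (u ^+ 2 + 2)) by ring.
rewrite oppr_ge0 pmulr_lle0; last by rewrite ltr_wpDl// sqr_ge0.
move=> b4; suff : b ^+ 4 == 0 by rewrite expf_eq0.
  by rewrite eq_le b4 -[4%N]/(2 * 2)%N exprM sqr_ge0.
Qed.

End differentials.

Section cutoffs.
Context (R : realType).

Definition pos_part (s : R) : R := Num.max 0 s.

Lemma pos_ge0 s : 0 <= pos_part s.
Proof. by rewrite le_max lexx. Qed.

Lemma continuous_pos : continuous pos_part.
Proof. by move=> s; apply: continuous_max; [exact: cvg_cst|exact: cvg_id]. Qed.

Lemma pos_sq_quadratic (s h : R) :
  `|pos_part (s + h) ^+ 2 - pos_part s ^+ 2 - 2 * pos_part s * h| <= h ^+ 2.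
Proof.
rewrite ler_norml /pos_part.
by apply/andP; case: (ltP 0 (s + h)) => ?; case: (ltP 0 s) => ?; split; nra.
Qed.

Lemma is_derive_pos_sq (s : R) : is_derive s 1 (fun s => pos_part s ^+ 2) (2 * pos_part s).
Proof.
apply: (@is_derive_quadratic _ _ 1) => // h; rewrite mul1r.
exact: pos_sq_quadratic.
Qed.

(** Half the second difference of the squared positive part: a C^1 transition from 0 at -1 to 1 at
    1. Its derivative [tent] is the hat function [max(0, 1 - |s|)]. *)
Definition step (s : R) : R :=
  (pos_part (s + 1) ^+ 2 - 2 * pos_part s ^+ 2 + pos_part (s - 1) ^+ 2) / 2.

Definition tent (s : R) : R := pos_part (s + 1) - 2 * pos_part s + pos_part (s - 1).

(** The three squares enter with weights 1, 2, 1 and are halved, whence the constant 2. *)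
Lemma step_quadratic (s h : R) :
  `|step (s + h) - step s - tent s * h| <= 2 * h ^+ 2.
Proof.
have := pos_sq_quadratic (s + 1) h; have := pos_sq_quadratic s h.
have := pos_sq_quadratic (s - 1) h.
rewrite /step /tent (addrAC s 1) (addrAC s (-1)) !ler_norml.
move=> /andP[? ?] /andP[? ?] /andP[? ?]; apply/andP; split; lra.
Qed.

Lemma is_derive_scaled_step (c e t : R) : 0 < e ->
  is_derive t 1 (fun t => step ((t - c) / e)) (tent ((t - c) / e) / e).
Proof.
move=> e0; apply: (@is_derive_quadratic _ _ (2 / e ^+ 2)).
  by rewrite divr_gt0// exprn_gt0.
move=> h; have -> : (t + h - c) / e = (t - c) / e + h / e.
  by rewrite -mulrDl addrAC.
have -> : 2 / e ^+ 2 * h ^+ 2 = 2 * (h / e) ^+ 2 by rewrite expr_div_n; ring.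
by rewrite (mulrAC (tent _)) -mulrA; exact: step_quadratic.
Qed.

Lemma continuous_tent : continuous tent.
Proof.
move=> s; apply: cvgD; first apply: cvgB.
- apply: (@cvg_comp _ _ _ (fun s => s + 1) pos_part); last exact: continuous_pos.
  by apply: cvgD; [exact: cvg_id|exact: cvg_cst].
- by apply: cvgM; [exact: cvg_cst|exact: continuous_pos].
- apply: (@cvg_comp _ _ _ (fun s => s - 1) pos_part); last exact: continuous_pos.
  by apply: cvgB; [exact: cvg_id|exact: cvg_cst].
Qed.

Lemma tent_ge0 (s : R) : 0 <= tent s <= 1.
Proof.
by rewrite /tent /pos_part; apply/andP; case: (ltP 0 (s + 1)) => ?; case: (ltP 0 s) => ?;
  case: (ltP 0 (s - 1)) => ?; split; lra.
Qed.

Lemma step_bounds (s : R) : 0 <= step s <= 1.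
Proof.
by rewrite /step /pos_part; apply/andP; case: (ltP 0 (s + 1)) => ?; case: (ltP 0 s) => ?;
  case: (ltP 0 (s - 1)) => ?; split; nra.
Qed.

Lemma step_le (s : R) : s <= -1 -> step s = 0.
Proof.
by move=> s1; rewrite /step /pos_part !max_l ?expr0n/=; lra.
Qed.

Lemma step_ge (s : R) : 1 <= s -> step s = 1.
Proof.
by move=> s1; rewrite /step /pos_part !max_r; lra.
Qed.

End cutoffs.

(** * Logarithmic cutoffs *)

Section log_cutoff.
Context (R : realType) (d : nat).
Implicit Types x : 'rV[R]_d.

Definition log_arg (n : nat) (x : 'rV[R]_d) : R :=
  1 - n.+1%:R^-1 * ln (1 + dotr x x).

Definition log_cutoff (n : nat) (x : 'rV[R]_d) : R := pos_part (log_arg n x) ^+ 2.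

(** The cutoff is radial, so its gradient at [x] is a scalar multiple of [x]; this is the scalar. *)
Definition log_slope (n : nat) (x : 'rV[R]_d) : R :=
  - (4 * pos_part (log_arg n x) * n.+1%:R^-1 * (1 + dotr x x)^-1).

Lemma one_dotr_gt0 x : 0 < 1 + dotr x x.
Proof. by rewrite ltr_pwDl// dotrr_ge0. Qed.

Lemma continuous_log_arg n (S : topologicalType) (g : S -> 'rV[R]_d) :
  continuous g -> continuous (fun s => log_arg n (g s)).
Proof.
move=> cg s; apply: cvgB; first exact: cvg_cst.
apply: cvgM; first exact: cvg_cst.
apply: (@cvg_comp _ _ _ (fun s => 1 + dotr (g s) (g s)) (@ln R)).
  by apply: cvgD; [exact: cvg_cst|exact: continuous_dotr].
exact: continuous_ln (one_dotr_gt0 (g s)).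
Qed.

Lemma continuous_pos_log n (S : topologicalType) (g : S -> 'rV[R]_d) :
  continuous g -> continuous (fun s => pos_part (log_arg n (g s))).
Proof.
move=> cg s; apply: (@cvg_comp _ _ _ (fun s => log_arg n (g s)) (@pos_part R)).
  exact: continuous_log_arg.
exact: continuous_pos.
Qed.

Lemma continuous_log_cutoff n (S : topologicalType) (g : S -> 'rV[R]_d) :
  continuous g -> continuous (fun s => log_cutoff n (g s)).
Proof. by move=> cg s; apply: cvgM; exact: continuous_pos_log. Qed.

Lemma continuous_log_slope n (S : topologicalType) (g : S -> 'rV[R]_d) :
  continuous g -> continuous (fun s => log_slope n (g s)).
Proof.
move=> cg s; apply: cvgN; apply: cvgM; first apply: cvgM.
- by apply: cvgM; [exact: cvg_cst|exact: continuous_pos_log].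
- exact: cvg_cst.
apply: cvgV; first by rewrite gt_eqF// one_dotr_gt0.
by apply: cvgD; [exact: cvg_cst|exact: continuous_dotr].
Qed.

Lemma log_arg_le1 n x : log_arg n x <= 1.
Proof. by rewrite gerBl mulr_ge0// ln_ge0// lerDl dotrr_ge0. Qed.

Lemma pos_log_le1 n x : pos_part (log_arg n x) <= 1.
Proof. by rewrite ge_max ler01 log_arg_le1. Qed.

Lemma log_cutoff_bounds n x : 0 <= log_cutoff n x <= 1.
Proof. by rewrite sqr_ge0 exprn_ile1// ?pos_ge0 ?pos_log_le1. Qed.

Lemma is_diff_log_cutoff n x :
  is_diff x (log_cutoff n) (fun h => log_slope n x * dotr x h).
Proof.
have D1 := is_diff_dotr x.
have D2 : is_diff (1 + dotr x x) (@ln R) (fun h => h * (1 + dotr x x)^-1).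
  by apply: is_derive_is_diff; apply: is_derive1_ln; exact: one_dotr_gt0.
have D3 : is_diff x (fun y : 'rV[R]_d => 1 + dotr y y) (fun h => 2 * dotr x h).
  have := is_diffD (is_diff_cst (1 : R) x) D1.
  by rewrite add0r.
have D4 := is_diff_comp D3 D2.
have D5 := is_diffB (is_diff_cst (1 : R) x) (is_diffZ n.+1%:R^-1 D4).
rewrite sub0r in D5.
have D6 : is_diff (log_arg n x) (fun s => pos_part s ^+ 2) (fun h => h * (2 * pos_part (log_arg n x))).
  by apply: is_derive_is_diff; exact: is_derive_pos_sq.
have := is_diff_comp D5 D6.
rewrite [X in is_diff _ _ X -> _](_ : _ = (fun h => log_slope n x * dotr x h)) //.
apply/funext => h /=; rewrite !fctE /= /log_slope /GRing.scale /=.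
by ring.
Qed.

(** With [r = enorm x], the inequality [r (1 + r) <= 2 (1 + r^2)] and the bound 1 on the positive
    part give [8 = 4 * 2]. The factor [1 / (1 + r)] is the weight of the growth hypothesis. *)
Lemma log_slope_bound n x :
  `|log_slope n x| * enorm x <= 8 / n.+1%:R / (1 + enorm x).
Proof.
have n0 : 0 < (n.+1%:R : R)^-1 by rewrite invr_gt0.
have r0 := enorm_ge0 x.
have p0 := pos_ge0 (log_arg n x); have p1 := pos_log_le1 n x.
rewrite /log_slope normrN -enorm_sq ger0_norm; last first.
  by rewrite !mulr_ge0// ?invr_ge0 ?addr_ge0 ?sqr_ge0.
have r1 : 0 < 1 + enorm x by rewrite ltr_pwDl.
have r2 : 0 < 1 + enorm x ^+ 2 by rewrite ltr_pwDl// sqr_ge0.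
rewrite ler_pdivlMr//.
have -> : 4 * pos_part (log_arg n x) / n.+1%:R / (1 + enorm x ^+ 2) * enorm x * (1 + enorm x)
  = (4 * pos_part (log_arg n x) * (enorm x * (1 + enorm x)) / n.+1%:R) / (1 + enorm x ^+ 2).
  by rewrite -!mulrA; congr (_ * (_ * _)); rewrite mulrCA [RHS]mulrCA; ring.
rewrite ler_pdivrMr// [leRHS]mulrAC ler_wpM2r//.
have : enorm x * (1 + enorm x) <= 2 * (1 + enorm x ^+ 2) by nra.
have : 0 <= enorm x * (1 + enorm x) by rewrite mulr_ge0// ltW.
move: (enorm x * _) (1 + _ ^+ 2) => u w u0 uw; nra.
Qed.

(** Where the cutoff is nonzero, [1 + |x|^2 < exp(n + 1)]. The radius is crude but enough, since
    [s <= 1 + s^2] for every real [s]. *)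
Lemma log_cutoff_support n x i : log_cutoff n x != 0 ->
  `|x 0 i| <= expR n.+1%:R.
Proof.
move=> h; have : 0 < log_arg n x.
  rewrite ltNge; apply/negP => a0; move: h.
  by rewrite /log_cutoff /pos_part max_l// expr0n eqxx.
rewrite subr_gt0 mulrC ltr_pdivrMr// mul1r => hl.
have : 1 + dotr x x < expR n.+1%:R.
  by rewrite -ltr_ln ?posrE ?expR_gt0 ?one_dotr_gt0// expRK.
have := sqr_coord_le x i; rewrite -(real_normK (num_real (x 0 i))).
have := normr_ge0 (x 0 i); have := dotrr_ge0 x.
move: (expR _) `|_| (dotr _ _) => a b c c0 b0 bc ca.
by rewrite leNgt; apply/negP => ab; nra.
Qed.

Lemma log_cutoff_cvg x : log_cutoff n x @[n --> \oo] --> (1 : R).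
Proof.
have h : log_arg n x @[n --> \oo] --> (1 : R).
  rewrite -[X in _ --> X]subr0; apply: cvgB; first exact: cvg_cst.
  rewrite -[X in _ --> X](mul0r (ln (1 + dotr x x))).
  apply: cvgMl; exact: cvg_harmonic.
have h2 : pos_part (log_arg n x) @[n --> \oo] --> (1 : R).
  have : pos_part (log_arg n x) @[n --> \oo] --> (pos_part 1 : R).
    by apply: (@cvg_comp _ _ _ (fun n => log_arg n x) (@pos_part R)) h _; exact: continuous_pos.
  by rewrite {2}/pos_part max_r.
by rewrite -[X in _ --> X](mulr1 1); exact: cvgM.
Qed.

End log_cutoff.

(** * Product test functions *)

Section product_test_function.
Context (R : realType) (Omega : completeMetricType R) (d : nat) (T : R).
Variables (eta eta' : R -> R) (psi : Omega -> R) (chi slope : 'rV[R]_d -> R).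
Variables (a b Ceta Ceta' M C r : R).
Hypothesis deta : forall t : R, is_derive t 1 eta (eta' t).
Hypothesis ceta' : continuous eta'.
Hypothesis eta_le : forall t, `|eta t| <= Ceta.
Hypothesis eta'_le : forall t, `|eta' t| <= Ceta'.
Hypothesis a0 : 0 < a.
Hypothesis bT : b < T.
Hypothesis eta_supp : forall t, eta t != 0 -> a <= t <= b.
Hypothesis cpsi : continuous psi.
Hypothesis psi_le : forall w, `|psi w| <= M.
Hypothesis dchi : forall x : 'rV[R]_d, is_diff x chi (fun h => slope x * dotr x h).
Hypothesis cslope : continuous slope.
Hypothesis chi_le : forall x, `|chi x| <= 1.
Hypothesis slope_le : forall x, `|slope x| * enorm x <= C.
Hypothesis chi_supp : forall x i, chi x != 0 -> `|x 0 i| <= r.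

Definition product_test (z : R * Omega * 'rV[R]_d) : R :=
  eta z.1.1 * psi z.1.2 * chi z.2.

Lemma continuous_eta : continuous eta.
Proof.
by move=> t; apply: differentiable_continuous; apply/derivable1_diffP; case: (deta t).
Qed.

Lemma continuous_chi : continuous chi.
Proof. by move=> x; apply: differentiable_continuous; case: (dchi x). Qed.

Lemma continuous_product_test : continuous product_test.
Proof.
move=> z; apply: cvgM; first apply: cvgM.
- apply: (@cvg_comp _ _ _ (fun z : R * Omega * 'rV[R]_d => z.1.1) eta); last exact: continuous_eta.
  by apply: (@cvg_comp _ _ _ fst fst); [exact: cvg_fst|exact: cvg_fst].
- apply: (@cvg_comp _ _ _ (fun z : R * Omega * 'rV[R]_d => z.1.2) psi); last exact: cpsi.
  by apply: (@cvg_comp _ _ _ fst snd); [exact: cvg_fst|exact: cvg_snd].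
- apply: (@cvg_comp _ _ _ (fun z : R * Omega * 'rV[R]_d => z.2) chi); last exact: continuous_chi.
  exact: cvg_snd.
Qed.

Definition product_diff w (z h : R * 'rV[R]_d) : R :=
  psi w * (chi z.2 * eta' z.1 * h.1 + eta z.1 * slope z.2 * dotr z.2 h.2).

Lemma continuous_product_diff w h : continuous (product_diff w ^~ h).
Proof.
move=> z.
have c1 : {for z, continuous (fun z : R * 'rV[R]_d => eta z.1)}.
  by apply: (@cvg_comp _ _ _ fst eta); [exact: cvg_fst|exact: continuous_eta].
have c2 : {for z, continuous (fun z : R * 'rV[R]_d => eta' z.1)}.
  by apply: (@cvg_comp _ _ _ fst eta'); [exact: cvg_fst|exact: ceta'].
have c3 : {for z, continuous (fun z : R * 'rV[R]_d => chi z.2)}.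
  by apply: (@cvg_comp _ _ _ snd chi); [exact: cvg_snd|exact: continuous_chi].
have c4 : {for z, continuous (fun z : R * 'rV[R]_d => slope z.2)}.
  by apply: (@cvg_comp _ _ _ snd slope); [exact: cvg_snd|exact: cslope].
have c5 : continuous (fun z : R * 'rV[R]_d => dotr z.2 h.2).
  apply: continuous_dotr; [by move=> ?; exact: cvg_snd|by move=> ?; exact: cvg_cst].
apply: cvgM; first exact: cvg_cst.
apply: cvgD.
  by apply: cvgM; [exact: cvgM|exact: cvg_cst].
by apply: cvgM; [exact: cvgM|exact: c5].
Qed.

Lemma is_diff_slice w z : is_diff z (slice product_test w) (product_diff w z).
Proof.
have dfst : is_diff z (fst : R * 'rV[R]_d -> R) fst.
  apply: DiffDef; first by apply: linear_differentiable => ?; exact: cvg_fst.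
  by rewrite diff_lin// => ?; exact: cvg_fst.
have dsnd : is_diff z (snd : R * 'rV[R]_d -> 'rV[R]_d) snd.
  apply: DiffDef; first by apply: linear_differentiable => ?; exact: cvg_snd.
  by rewrite diff_lin// => ?; exact: cvg_snd.
have D1 := is_diff_comp dfst (is_derive_is_diff (deta z.1)).
have D2 := is_diff_comp dsnd (dchi z.2).
have := is_diffZ (psi w) (is_diffM D1 D2).
rewrite [X in is_diff _ X _ -> _](_ : _ = slice product_test w).
  rewrite [X in is_diff _ _ X -> _](_ : _ = product_diff w z) //.
  apply/funext => h; rewrite /product_diff !fctE /GRing.scale /=; ring.
by apply/funext => y; rewrite /slice /product_test !fctE /GRing.scale /=; ring.
Qed.

Lemma dt_product_test w z :
  dt (slice product_test w) z = eta' z.1 * psi w * chi z.2.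
Proof.
rewrite /dt derive1E.
have D1 := is_derive_is_diff (deta z.1).
have D2 := is_diffZ (psi w * chi z.2) D1.
rewrite (_ : (fun s => _) = (psi w * chi z.2) *: eta); last first.
  by apply/funext => y; rewrite /slice /product_test !fctE /GRing.scale /=; ring.
rewrite deriveE; last by case: D2.
by case: D2 => _ ->; rewrite !fctE /GRing.scale /=; ring.
Qed.

Lemma gradx_product_test w z :
  gradx (slice product_test w) z = (eta z.1 * psi w * slope z.2) *: z.2.
Proof.
apply/rowP => i; rewrite !mxE.
have D2 := is_diffZ (eta z.1 * psi w) (dchi z.2).
rewrite (_ : (fun s => _) = (eta z.1 * psi w) *: chi); last first.
  by apply/funext => y; rewrite /slice /product_test !fctE /GRing.scale /=; ring.
rewrite deriveE; last by case: D2.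
case: D2 => _ ->; rewrite !fctE /GRing.scale /=.
rewrite /dotr (bigD1 i)//= big1 ?addr0; last first.
  by move=> j /negbTE ji; rewrite mxE ji andbF mulr0.
by rewrite mxE !eqxx mulr1; ring.
Qed.

Lemma Adm_product_test : Adm T product_test.
Proof.
have Ce0 : 0 <= Ceta by apply: le_trans (eta_le 0).
have Ce'0 : 0 <= Ceta' by apply: le_trans (eta'_le 0).
have bound w z : `|slice product_test w z| <= Ceta * M.
  rewrite !normrM -[leRHS]mulr1 ler_pM// ?mulr_ge0//.
  by rewrite ler_pM.
split.
- exact: continuous_subspaceT continuous_product_test.
- exists (Ceta * M) => -[[t w] x] _; exact: (bound w (t, x)).
- move=> w; split.
    move=> z _; split; first by case: (is_diff_slice w z).
    move=> h; have E : (fun y => 'd (slice product_test w) y h) = product_diff w ^~ h.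
      by apply/funext => y; case: (is_diff_slice w y) => _ ->.
    by rewrite E; exact: continuous_product_diff.
  exists (`[a, b] `*` [set x : 'rV[R]_d | forall i, `[- r, r]%classic (x 0 i)]); split.
  + apply: compact_setX; first exact: segment_compact.
    by apply: (@rV_compact _ _ (fun=> `[- r, r]%classic)) => i; exact: segment_compact.
  + move=> z [/=]; rewrite !in_itv /= => /andP[az zb] _.
    by rewrite (lt_le_trans a0 az) (le_lt_trans zb bT).
  + move=> z _; rewrite /slice /product_test /= !mulf_eq0 !negb_or.
    move=> /andP[/andP[ez _] cz]; split => /=; first by rewrite in_itv /= eta_supp.
    by move=> i; rewrite in_itv /= -ler_norml chi_supp.
- apply: (@le_lt_trans _ _ (Ceta * M + Ceta' * M + Ceta * M * C)%:E); last exact: ltry.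
  apply: ge_ereal_sup => _ [w _ <-]; rewrite /C1norm !EFinD.
  apply: leeD; first apply: leeD.
  + by apply: ge_ereal_sup => _ [z _ <-]; rewrite lee_fin.
  + apply: ge_ereal_sup => _ [z _ <-]; rewrite lee_fin dt_product_test.
    rewrite !normrM -[leRHS]mulr1 ler_pM// ?mulr_ge0//.
    by rewrite ler_pM.
  + apply: ge_ereal_sup => _ [z _ <-]; rewrite lee_fin gradx_product_test.
    rewrite enormZ normrM -[leLHS]mulrA ler_pM// ?mulr_ge0// ?enorm_ge0//.
    by rewrite normrM ler_pM.
Qed.

(** The field [v] is confined to the second summand; for fixed [t] the first one is a bounded
    continuous function of [z] when [psi] and [chi] are. *)
Lemma pairing_product_test v t z :
  pairing product_test v t z = eta' t * (psi z.1 * chi z.2)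
    + eta t * psi z.1 * slope z.2 * dotr z.2 (v (t, z.1, z.2)).
Proof.
by rewrite /pairing dt_product_test gradx_product_test dotrZl /= mulrA.
Qed.

End product_test_function.

(** * Vanishing of the flux *)

Lemma aeS d (X : semiRingOfSetsType d) (R : realFieldType) (mu : set X -> \bar R)
    (P Q : X -> Prop) : (forall x, P x -> Q x) ->
  {ae mu, forall x, P x} -> {ae mu, forall x, Q x}.
Proof.
move=> PQ [N [mN N0 PN]]; exists N; split => // x Qx; apply: PN => /= /PQ.
exact: Qx.
Qed.

Lemma aeI d (X : ringOfSetsType d) (R : realFieldType)
    (mu : {measure set X -> \bar R}) (P Q : X -> Prop) :
  {ae mu, forall x, P x} -> {ae mu, forall x, Q x} ->
  {ae mu, forall x, P x /\ Q x}.
Proof.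
by move=> aP aQ; apply: negligibleS (negligibleU aP aQ) => x /not_andP.
Qed.

(** As [f] may fail to be measurable, monotonicity of the lower integral comes first, and additivity
    is applied to the majorant [A + c g] only. If [g] has infinite integral, the right-hand side is
    [+oo]. *)
Lemma lower_integral_le_split (R : realType) (X : ptopologicalType)
    (P : probability (borel X) R) (f : borel X -> \bar R) (A : X -> R) (c M : R)
    (g : borel X -> \bar R) :
  continuous A -> (forall z, `|A z| <= M) -> 0 < c -> measurable_fun setT g ->
  (forall z, 0 <= g z)%E ->
  {ae P, forall z, (f z <= (A z)%:E + c%:E * g z)%E} ->
  (\int[P]_z f z <= (\int[P]_z A z)%:E + c%:E * \int[P]_z g z)%E.
Proof.
move=> cA AM c0 mg g0 fA.
have iA := bounded_continuous_integrable P cA AM.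
have [goo|goo] := eqVneq (\int[P]_z g z)%E +oo%E.
  by rewrite goo gt0_muley ?lte_fin// addey// leey.
have ig : P.-integrable setT g.
  apply/integrableP; split => //.
  under eq_integral do rewrite gee0_abs//.
  by rewrite ltey.
apply: (@le_trans _ _ (\int[P]_z ((A z)%:E + c%:E * g z))%E).
  by apply: lower_integral_le; apply: aeS fA => z + _.
rewrite integralD//; last exact: integrableZl.
rewrite integralZl// /Rintegral fineK//.
exact: integrable_fin_num.
Qed.

Lemma lebesgue_segment_lty (R : realType) (a b : R) :
  (lebesgue_measure (`[a, b]%classic : set R) < +oo)%E.
Proof. by rewrite lebesgue_measure_itv /=; case: ifP; rewrite ?ltry. Qed.

Lemma bounded_segment_integrable (R : realType) (a b M : R) (f : R -> R) :
  measurable_fun `[a, b] f -> (forall t, t \in `[a, b] -> `|f t| <= M) ->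
  lebesgue_measure.-integrable `[a, b] (EFin \o f).
Proof.
move=> mf fM; have oo := lebesgue_segment_lty a b.
apply: measurable_bounded_integrable => //.
exists M; split; first exact: num_real.
by move=> x xM t tab; apply: le_trans (fM t tab) (ltW xM).
Qed.

Section vanishing_flux.
Context (R : realType) (Omega : completeMetricType R) (d : nat) (T : R).
Let state : ptopologicalType := (Omega * 'rV[R]_d)%type.
Variable v : R * Omega * 'rV[R]_d -> 'rV[R]_d.
Variable mu : R -> probability (borel state) R.
Hypothesis mmu : Borel_curve T mu.
Hypothesis appr : approximable_opens R state.
Hypothesis solmu : distributional_solution T v mu.
Hypothesis growth : integrable_along T mu
       (fun t z => enorm (v (t, z.1, z.2)) / (1 + enorm z.2)).

Let h t (z : state) := enorm (v (t, z.1, z.2)) / (1 + enorm z.2).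

(** [G t] integrates the absolute value of a Borel representative of the growth quotient [h]. The
    exceptional null set of times is fixed before [f], [A], [c] and [M], so one [G] serves all test
    functions. *)
Lemma growth_majorant : exists G : R -> \bar R,
  lebesgue_measure.-integrable `[0, T] G /\
  {ae lebesgue_measure, forall t : R, t \in `[0, T] ->
    forall (f : borel state -> \bar R) (A : state -> R) (c M : R),
      continuous A -> (forall z, `|A z| <= M) -> 0 < c ->
      (forall z, (f z <= (A z + c * h t z)%:E)%E) ->
      (\int[mu t]_z f z <= (\int[mu t]_z A z)%:E + c%:E * G t)%E}.
Proof.
have [[g mg hg] hoo] := growth.
pose k (z : R * borel state) : \bar R := `|g z|%:E.
have mk : measurable_fun setT k by apply/measurable_EFinP; exact: measurableT_comp.
have k0 z : (0 <= k z)%E by rewrite lee_fin.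
have h0 t z : 0 <= h t z by rewrite divr_ge0 ?addr_ge0 ?enorm_ge0.
pose G t := (\int[mu t]_z k (t, z))%E.
have G0 t : (0 <= G t)%E by exact: integral_ge0.
have mG : measurable_fun `[0, T] G by exact: Borel_curve_integral_measurable.
have mkt t : measurable_fun setT (fun z : borel state => k (t, z)).
  exact: (measurableT_comp mk (pair1_measurable t)).
exists G; split.
  apply/integrableP; split => //.
  (* The two nested integrals are compared as lower integrals, so measurability of [h] is never
     invoked. *)
  apply: le_lt_trans hoo.
  apply: lower_integral_le; apply: aeS hg => t ht tT.
  rewrite gee0_abs//.
  apply: lower_integral_le; apply: aeS (ht tT) => z /= hz _.
  by rewrite /k hz.
apply: aeS hg => t ht tT f A c M cA AM c0 fA.
apply: (lower_integral_le_split cA AM c0) => //.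
apply: aeS (ht tT) => z hz; apply: le_trans (fA z) _.
by rewrite EFinD EFinM leeD2l// lee_pmul2l ?lte_fin// /k -hz lee_fin ler_norm.
Qed.

Section fixed_time_test.
Variables (eta eta' : R -> R) (a b Ceta Ceta' : R).
Hypothesis deta : forall t : R, is_derive t 1 eta (eta' t).
Hypothesis ceta' : continuous eta'.
Hypothesis eta_le : forall t, `|eta t| <= Ceta.
Hypothesis eta'_le : forall t, `|eta' t| <= Ceta'.
Hypothesis a0 : 0 < a.
Hypothesis bT : b < T.
Hypothesis eta_supp : forall t, eta t != 0 -> a <= t <= b.

Lemma continuous_truncation (psi : Omega -> R) n : continuous psi ->
  continuous (fun z : state => psi z.1 * log_cutoff n z.2).
Proof.
move=> cpsi z; apply: cvgM.
  by apply: (@cvg_comp _ _ _ fst psi); [exact: cvg_fst|exact: cpsi].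
by apply: continuous_log_cutoff => y; exact: cvg_snd.
Qed.

Lemma truncation_le (psi : Omega -> R) M n : (forall w, `|psi w| <= M) ->
  forall z : state, `|psi z.1 * log_cutoff n z.2| <= M.
Proof.
move=> psiM z; rewrite normrM -[leRHS]mulr1 ler_pM//.
by have /andP[c0 c1] := log_cutoff_bounds n z.2; rewrite ger0_norm.
Qed.

(** The flux part of the pairing is at most [c * h] with [c = 8 M (Ceta + 1) / (n + 1)], so the
    vanishing integral of the whole pairing is at most the time part plus [c] times the integral of
    [|G|]. The constant [K] is chosen before [psi], [M] and [n]. *)
Lemma truncated_flux_ge0 : exists2 K : R, 0 <= K & forall (psi : Omega -> R) (M : R),
  continuous psi -> 0 < M -> (forall w, `|psi w| <= M) -> forall n,
  0 <= \int[lebesgue_measure]_(t in `[0, T])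
         (eta' t * \int[mu t]_z (psi z.1 * log_cutoff n z.2)) + M * K / n.+1%:R.
Proof.
have [G [iG hG]] := growth_majorant.
(* The [+ 1] keeps [c] positive even if [Ceta = 0], as [growth_majorant] demands. *)
pose K1 := 8 * (Ceta + 1).
have Ce0 : 0 <= Ceta by apply: le_trans (eta_le 0).
have K10 : 0 < K1 by rewrite mulr_gt0// ltr_wpDl.
pose I := fine (\int[lebesgue_measure]_(t in `[0%R, T]) `|G t|)%E.
have I0 : 0 <= I by rewrite fine_ge0// integral_ge0.
exists (K1 * I); first by rewrite mulr_ge0// ltW.
move=> psi M cpsi M0 psiM n.
pose c := M * K1 / n.+1%:R.
have c0 : 0 < c by rewrite divr_gt0// mulr_gt0.
have chi_le x : `|log_cutoff n (x : 'rV[R]_d)| <= 1.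
  by have /andP[l0 l1] := log_cutoff_bounds n x; rewrite ger0_norm.
have slope_le (x : 'rV[R]_d) : `|log_slope n x| * enorm x <= 8 / n.+1%:R.
  apply: le_trans (log_slope_bound n x) _.
  rewrite ler_pdivrMr ?ltr_pwDl ?enorm_ge0//.
  by rewrite ler_peMr ?divr_ge0// lerDl enorm_ge0.
have adm : Adm T (product_test eta psi (@log_cutoff R d n)).
  apply: (@Adm_product_test R Omega d T eta eta' psi _ (@log_slope R d n)
    a b Ceta Ceta' M (8 / n.+1%:R) (expR n.+1%:R)) => //.
  - exact: is_diff_log_cutoff.
  - by apply: (@continuous_log_slope R d n 'rV[R]_d id) => x; exact: cvg_id.
  - exact: log_cutoff_support.
have [_ int0] := solmu adm.
pose Af t := eta' t * \int[mu t]_z (psi z.1 * log_cutoff n z.2).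
have cA := @continuous_truncation psi n cpsi.
have AM := @truncation_le psi M n psiM.
have mAf : measurable_fun `[0, T] Af.
  apply: measurable_funM.
    apply: measurable_funTS; exact: continuous_measurable_fun.
  exact: (Borel_curve_integral mmu cA AM).
have Af_le t : `|Af t| <= Ceta' * M.
  by rewrite normrM ler_pM// normr_Rintegral_le.
have iAf : lebesgue_measure.-integrable `[0, T] (EFin \o Af).
  exact: (@bounded_segment_integrable _ _ _ (Ceta' * M)).
rewrite -lee_fin EFinD -[leLHS]/(0%E) -[leLHS]int0.
rewrite /Rintegral fineK; last exact: integrable_fin_num.
apply: (@le_trans _ _ (\int[lebesgue_measure]_(t in `[0%R, T]) ((Af t)%:E + c%:E * `|G t|))%E).
  apply: lower_integral_le; apply: aeS hG => t ht tT.
  apply: (@le_trans _ _ ((Af t)%:E + c%:E * G t)%E); last first.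
    by rewrite leeD2l// lee_pmul2l ?lte_fin// lee_abs.
  have -> : Af t = \int[mu t]_z (eta' t * (psi z.1 * log_cutoff n z.2)).
    rewrite RintegralZl//; exact: (bounded_continuous_integrable (mu t) cA AM).
  apply: (ht tT _ _ _ (`|eta' t| * M)) => //.
  - by move=> z; apply: cvgM; [exact: cvg_cst|exact: cA].
  - by move=> z; rewrite normrM ler_pM.
  move=> z; rewrite lee_fin (pairing_product_test psi deta (@is_diff_log_cutoff R d n)).
  rewrite lerD2l (le_trans (ler_norm _))// normrM.
  apply: (@le_trans _ _ (`|eta t * psi z.1 * log_slope n z.2| * (enorm z.2 * enorm (v (t, z.1, z.2))))).
    by rewrite ler_wpM2l// normr_dotr.
  have -> : c * h t z = (Ceta + 1) * M * (8 / n.+1%:R / (1 + enorm z.2))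
      * enorm (v (t, z.1, z.2)) by rewrite /c /K1 /h; ring.
  rewrite mulrA ler_wpM2r ?enorm_ge0// !normrM -[leLHS]mulrA.
  rewrite ler_pM ?mulr_ge0// ?enorm_ge0//; last exact: log_slope_bound.
  by rewrite ler_pM// (le_trans (eta_le t))// lerDl.
rewrite integralD//; last first.
  apply: integrableZl => //; exact: integrable_abse.
rewrite integralZl//; last exact: integrable_abse.
rewrite leeD2l// /c.
have fI : (\int[lebesgue_measure]_(t in `[0%R, T]) `|G t|)%E \is a fin_num.
  apply: integrable_fin_num => //; exact: integrable_abse.
rewrite -(fineK fI) -/I -EFinM lee_fin.
by rewrite mulrAC mulrA.
Qed.

Lemma flux_ge0 (psi : Omega -> R) (M : R) : continuous psi -> 0 < M ->
  (forall w, `|psi w| <= M) ->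
  0 <= \int[lebesgue_measure]_(t in `[0, T]) (eta' t * \int[mu t]_z psi z.1).
Proof.
move=> cpsi M0 psiM.
have [K K0 HK] := truncated_flux_ge0.
have cA n := @continuous_truncation psi n cpsi.
have AM n := @truncation_le psi M n psiM.
have inner t : \int[mu t]_z (psi z.1 * log_cutoff n z.2) @[n --> \oo] -->
    \int[mu t]_z psi z.1.
  apply: (@bounded_cvg_Rintegral R state (mu t)
    (fun n (z : state) => psi z.1 * log_cutoff n z.2) _ M cA AM) => z.
  rewrite -[X in _ --> X]mulr1.
  by apply: cvgMr; exact: log_cutoff_cvg.
have outer : \int[lebesgue_measure]_(t in `[0, T])
    (eta' t * \int[mu t]_z (psi z.1 * log_cutoff n z.2)) @[n --> \oo] -->
    \int[lebesgue_measure]_(t in `[0, T]) (eta' t * \int[mu t]_z psi z.1).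
  apply: (@bounded_cvg_RintegralD _ _ _ lebesgue_measure _ _ _ (Ceta' * M)) => //.
  - exact: lebesgue_segment_lty.
  - move=> n; apply: measurable_funM.
      by apply: measurable_funTS; exact: continuous_measurable_fun.
    exact: (Borel_curve_integral mmu (cA n) (AM n)).
  - by move=> n t _; rewrite normrM ler_pM// normr_Rintegral_le.
  - by move=> t _; apply: cvgMr.
have rem : M * K / n.+1%:R @[n --> \oo] --> (0 : R).
  rewrite -[X in _ --> X](mulr0 (M * K)).
  by apply: cvgMr; exact: cvg_harmonic.
have lim : \int[lebesgue_measure]_(t in `[0, T])
    (eta' t * \int[mu t]_z (psi z.1 * log_cutoff n z.2)) + M * K / n.+1%:R
    @[n --> \oo] --> \int[lebesgue_measure]_(t in `[0, T]) (eta' t * \int[mu t]_z psi z.1).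
  by rewrite -[X in _ --> X]addr0; exact: cvgD.
rewrite -(cvg_lim (@Rhausdorff R) lim).
apply: limr_ge; first exact: cvgP lim.
by apply: nearW => n; exact: HK.
Qed.

(** The expression is linear in [psi], so [flux_ge0] for [- psi] is the reverse inequality. *)
Lemma flux_eq0 (psi : Omega -> R) (M : R) : continuous psi -> 0 < M ->
  (forall w, `|psi w| <= M) ->
  \int[lebesgue_measure]_(t in `[0, T]) (eta' t * \int[mu t]_z psi z.1) = 0.
Proof.
move=> cpsi M0 psiM; apply/eqP; rewrite eq_le (flux_ge0 cpsi M0 psiM) andbT.
rewrite -oppr_ge0.
have cN : continuous (fun w => - psi w) by move=> w; apply: cvgN; exact: cpsi.
have NM w : `|- psi w| <= M by rewrite normrN.
have := flux_ge0 cN M0 NM.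
have cp : continuous (fun z : state => psi z.1).
  by move=> z; apply: (@cvg_comp _ _ _ fst psi); [exact: cvg_fst|exact: cpsi].
have pM (z : state) : `|psi z.1| <= M by [].
rewrite (_ : \int[_]_(t in _) _ =
  \int[lebesgue_measure]_(t in `[0, T]) (-1 * (eta' t * \int[mu t]_z psi z.1))).
  rewrite RintegralZl ?mulN1r//.
  apply: (@bounded_segment_integrable _ _ _ (Ceta' * M)) => [|t _].
    apply: measurable_funM.
      by apply: measurable_funTS; exact: continuous_measurable_fun.
    exact: (Borel_curve_integral mmu cp pM).
  by rewrite normrM ler_pM// normr_Rintegral_le.
apply: eq_Rintegral => t _.
rewrite -[in RHS]mulrCA; congr (_ * _).
rewrite -RintegralZl//; last exact: (bounded_continuous_integrable (mu t) cp pM).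
by apply: eq_Rintegral => z _; rewrite mulN1r.
Qed.

End fixed_time_test.
End vanishing_flux.

(** * Lebesgue points *)

Section tent_average.
Context (R : realType) (T : R).
Implicit Types (a e t : R).

(** The derivative of [step ((t - a) / e)]: a hat of unit mass that vanishes outside [ball a e]. *)
Definition scaled_tent a e t : R := tent ((t - a) / e) / e.

Lemma continuous_scaled_tent a e : continuous (scaled_tent a e).
Proof.
move=> t; apply: cvgM; last exact: cvg_cst.
apply: (@cvg_comp _ _ _ (fun t => (t - a) / e) (@tent R)); last exact: continuous_tent.
by apply: cvgM; [apply: cvgB; [exact: cvg_id|exact: cvg_cst]|exact: cvg_cst].
Qed.

Lemma scaled_tent_bounds a e t : 0 < e -> 0 <= scaled_tent a e t <= e^-1.
Proof.
move=> e0; have /andP[t0 t1] := tent_ge0 ((t - a) / e).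
have ei : 0 <= e^-1 by rewrite invr_ge0 ltW.
by rewrite mulr_ge0//= -[leRHS]mul1r ler_wpM2r.
Qed.

Lemma tent_out (s : R) : 1 <= `|s| -> tent s = 0.
Proof.
rewrite ler_normr /tent /pos_part => /orP[] s1.
  by rewrite !max_r; lra.
by rewrite !max_l; lra.
Qed.

Lemma scaled_tent_out a e t : 0 < e -> ~ ball a e t -> scaled_tent a e t = 0.
Proof.
move=> e0 /negP; rewrite /ball /= -leNgt distrC => ht.
rewrite /scaled_tent tent_out ?mul0r// normrM normfV (gtr0_norm e0).
by rewrite ler_pdivlMr// mul1r.
Qed.

Lemma scaled_tent_integral a e : 0 < e -> 0 <= a - e -> a + e <= T ->
  \int[lebesgue_measure]_(t in `[0, T]) scaled_tent a e t = 1.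
Proof.
move=> e0 ae aeT; have T0 : 0 < T by lra.
have D t := is_derive_scaled_step a t e0.
have cS : continuous (fun t => step ((t - a) / e)).
  move=> t; apply: differentiable_continuous; apply/derivable1_diffP.
  by case: (D t).
rewrite /Rintegral (@continuous_FTC2 _ _ (fun t => step ((t - a) / e)))//.
- rewrite step_ge; last by rewrite ler_pdivlMr//; lra.
  by rewrite step_le ?sube0// ler_pdivrMr//; lra.
- exact: continuous_subspaceT (@continuous_scaled_tent a e).
- split.
  + by move=> t _; case: (D t).
  + exact: cvg_at_right_filter (cS 0).
  + exact: cvg_at_left_filter (cS T).
- by move=> t _; rewrite derive1E; case: (D t).
Qed.

Variables (g : R -> R) (M : R).
Hypothesis mg : measurable_fun `[0, T] g.
Hypothesis gM : forall t, `|g t| <= M.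

Let mI : measurable (`[0, T]%classic : set R). Proof. exact: measurable_itv. Qed.

(** Unit mass allows [g a] to be moved under the integral. The tent is at most [1 / e] and lives on
    a ball of length [2 e], so replacing it by [1 / e] costs a factor 2 against the mean over the
    ball. *)
Lemma tent_average_le a e : 0 < e -> 0 <= a - e -> a + e <= T ->
  (`|\int[lebesgue_measure]_(t in `[0%R, T]) (scaled_tent a e t * g t) - g a|%:E
   <= 2%:E * davg (g \_ `[0%R, T]) a e)%E.
Proof.
move=> e0 ae aeT.
have aI : a \in `[0, T] by rewrite in_itv /=; apply/andP; split; lra.
have mK : measurable_fun `[0, T] (scaled_tent a e).
  by apply: measurable_funTS; apply: continuous_measurable_fun; exact: continuous_scaled_tent.
have Kb t : `|scaled_tent a e t| <= e^-1.
  by have /andP[k0 k1] := scaled_tent_bounds a t e0; rewrite ger0_norm.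
have iK : lebesgue_measure.-integrable `[0, T] (EFin \o scaled_tent a e).
  by apply: (@bounded_segment_integrable _ _ _ e^-1).
have iKg : lebesgue_measure.-integrable `[0, T] (EFin \o (fun t => scaled_tent a e t * g t)).
  apply: (@bounded_segment_integrable _ _ _ (e^-1 * M)) => [|t _].
    exact: measurable_funM.
  by rewrite normrM ler_pM.
pose w t := scaled_tent a e t * g t - scaled_tent a e t * g a.
have iKa : lebesgue_measure.-integrable `[0, T] (EFin \o (fun t => scaled_tent a e t * g a)).
  apply: (@bounded_segment_integrable _ _ _ (e^-1 * M)) => [|t _].
    exact: measurable_funM.
  by rewrite normrM ler_pM.
have iw : lebesgue_measure.-integrable `[0, T] (EFin \o w).
  apply: (@bounded_segment_integrable _ _ _ (e^-1 * M + e^-1 * M)) => [|t _].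
    by apply: measurable_funB; exact: measurable_funM.
  by rewrite (le_trans (ler_normB _ _))// lerD// normrM ler_pM.
have -> : \int[lebesgue_measure]_(t in `[0%R, T]) (scaled_tent a e t * g t) - g a
    = \int[lebesgue_measure]_(t in `[0%R, T]) w t.
  rewrite RintegralB//; congr (_ - _).
  rewrite -[LHS]mul1r -(scaled_tent_integral e0 ae aeT) -RintegralZr//.
apply: (@le_trans _ _ (\int[lebesgue_measure]_(t in `[0%R, T]) `|w t|%:E)%E).
  apply: (@le_trans _ _ (\int[lebesgue_measure]_(t in `[0%R, T]) `|w t|)%:E).
    by rewrite lee_fin le_normr_Rintegral.
  rewrite /Rintegral fineK//; apply: integrable_fin_num => //.
  exact: integrable_norm.
pose G := g \_ `[0%R, T].
have mG : measurable_fun setT G by exact: (measurable_restrictT g mI).1.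
apply: (@le_trans _ _ (\int[lebesgue_measure]_(t in ball a e) (e^-1%:E * `|G t - G a|%:E))%E).
  rewrite integral_mkcond [leRHS]integral_mkcond.
  apply: lower_integral_le; apply: aeW => t _.
  rewrite /G !patchE; case: ifPn => tI; last first.
    by case: ifPn => // _; rewrite mule_ge0// lee_fin ?invr_ge0 ?ltW.
  rewrite (mem_set (aI : [set` `[0, T]] a)).
  case: ifPn => [tb|/negP tb].
    by rewrite -EFinM lee_fin /w -mulrBr normrM ler_wpM2r.
  rewrite /w scaled_tent_out// ?mul0r ?subr0 ?normr0//.
  by move=> h; apply: tb; exact: mem_set.
rewrite ge0_integralZl//; last 3 first.
- exact: measurable_ball.
- apply: measurable_funTS; apply/measurable_EFinP; apply: measurableT_comp => //.
  exact: measurable_funB.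
- by rewrite lee_fin invr_ge0 ltW.
rewrite /davg /iavg (lebesgue_measure_ball _ (ltW e0)) muleA.
rewrite inver mulrn_eq0 /= gt_eqF//= -EFinM.
rewrite -[e *+ 2]mulr_natl invfM mulrA divff// mul1r.
exact: lexx.
Qed.

(* The weighted average of [g] over a tent around [x] differs from [g x] by at most
   [2 davg g x e], which vanishes with [e] at a Lebesgue point. *)
Lemma lebesgue_pt_tent_eq a b : 0 < a < T -> 0 < b < T ->
  lebesgue_pt (g \_ `[0, T]) a -> lebesgue_pt (g \_ `[0, T]) b ->
  (forall e, 0 < e -> 0 < Num.min a b - e -> Num.max a b + e < T ->
    \int[lebesgue_measure]_(t in `[0, T])
      ((scaled_tent a e t - scaled_tent b e t) * g t) = 0) ->
  g a = g b.
Proof.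
move=> /andP[a0 aT] /andP[b0 bT] la lb H.
apply/eqP; rewrite -subr_eq0 -normr_le0; apply/ler_addgt0Pl => d d0; rewrite addr0.
(* Each of the two tent averages is off by at most [2 * (d / 4)], which adds up to [d]. *)
have d4 : 0 < d / 4 by rewrite divr_gt0.
have near_small x : lebesgue_pt (g \_ `[0, T]) x ->
    \forall e \near 0^'+, (davg (g \_ `[0%R, T]) x e < (d / 4)%:E)%E.
  move=> lx; apply: (lx [set y | (y < (d / 4)%:E)%E]); apply: open_nbhs_nbhs.
  by split; [exact: open_ereal_lt_ereal|rewrite /= lte_fin].
suff : \forall e \near (0 : R)^'+, `|g a - g b| <= d.
  by move=> h; have [e] := filter_ex h.
near=> e.
have e0 : 0 < e by near: e; exact: nbhs_right_gt.
have em : e < Num.min a b.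
  by near: e; apply: nbhs_right_lt; rewrite lt_min a0 b0.
have eM : e < T - Num.max a b.
  by near: e; apply: nbhs_right_lt; rewrite subr_gt0 gt_max aT bT.
have ha : (davg (g \_ `[0%R, T]) a e < (d / 4)%:E)%E by near: e; exact: near_small.
have hb : (davg (g \_ `[0%R, T]) b e < (d / 4)%:E)%E by near: e; exact: near_small.
have [ma mb] : Num.min a b <= a /\ Num.min a b <= b by rewrite !ge_min !lexx orbT.
have [Ma Mb] : a <= Num.max a b /\ b <= Num.max a b by rewrite !le_max !lexx orbT.
have He : \int[lebesgue_measure]_(t in `[0, T])
      ((scaled_tent a e t - scaled_tent b e t) * g t) = 0 by apply: H => //; lra.
have bound x : e <= x -> x + e <= T -> (davg (g \_ `[0%R, T]) x e < (d / 4)%:E)%E ->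
    `|\int[lebesgue_measure]_(t in `[0, T]) (scaled_tent x e t * g t) - g x| <= d / 2.
  move=> ex xT hx; rewrite -lee_fin.
  apply: le_trans (tent_average_le e0 _ xT) _; first by rewrite subr_ge0.
  apply: (@le_trans _ _ (2%:E * (d / 4)%:E)%E); first by rewrite lee_pmul2l// ltW.
  by rewrite -EFinM lee_fin; lra.
have iKg x : lebesgue_measure.-integrable `[0, T] (EFin \o (fun t => scaled_tent x e t * g t)).
  apply: (@bounded_segment_integrable _ _ _ (e^-1 * M)) => [|t _].
    apply: measurable_funM => //.
    by apply: measurable_funTS; apply: continuous_measurable_fun; exact: continuous_scaled_tent.
  rewrite normrM ler_pM//.
  by have /andP[k0 k1] := scaled_tent_bounds x t e0; rewrite ger0_norm.
have Hab : \int[lebesgue_measure]_(t in `[0, T]) (scaled_tent a e t * g t) =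
           \int[lebesgue_measure]_(t in `[0, T]) (scaled_tent b e t * g t).
  apply/eqP; rewrite -subr_eq0 -RintegralB//; apply/eqP; rewrite -[RHS]He.
  by apply: eq_Rintegral => t _; rewrite mulrBl.
have := bound a _ _ ha; rewrite Hab => /(_ ltac:(lra) ltac:(lra)).
have := bound b _ _ hb => /(_ ltac:(lra) ltac:(lra)).
move: (\int[_]_(t in _) _) => J.
by rewrite !ler_norml => /andP[? ?] /andP[? ?]; apply/andP; split; lra.
Unshelve. all: by end_near. Qed.

Lemma ae_constant_of_tents :
  (forall a b e, 0 < e -> 0 < Num.min a b - e -> Num.max a b + e < T ->
    \int[lebesgue_measure]_(t in `[0, T])
      ((scaled_tent a e t - scaled_tent b e t) * g t) = 0) ->
  exists c : R, {ae lebesgue_measure, forall t : R, t \in `[0, T] -> g t = c}.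
Proof.
move=> H; pose G := g \_ `[0%R, T].
have locG : locally_integrable setT G.
  apply: integrable_locally_restrict => //.
  by apply: (@bounded_segment_integrable _ _ _ M).
have aeG := lebesgue_differentiation locG.
have ae_interior : {ae lebesgue_measure, forall t : R, t \in `[0, T] ->
    0 < t < T /\ lebesgue_pt G t}.
  (* Tents must fit inside the open interval, so the two endpoints are discarded as a null set. *)
  have aeN : {ae lebesgue_measure, forall t : R, t != 0 /\ t != T}.
    exists [set 0; T]; split.
    - exact: measurableU.
    - by apply: countable_lebesgue_measure0; exact: finite_set_countable.
    - by move=> t /= /not_andP[] /negP; rewrite negbK => /eqP ->; [left|right].
  have aeGN : {ae lebesgue_measure, forall t : R,
      lebesgue_pt G t /\ (t != 0 /\ t != T)} by exact: aeI.
  apply: aeS aeGN => t [lt [t0 tT]]; rewrite in_itv /= => /andP[? ?]; split => //.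
  by rewrite !lt_neqAle eq_sym t0 tT /=; apply/andP.
have [[a [aT la]]|noL] := pselect (exists a, 0 < a < T /\ lebesgue_pt G a).
  exists (g a); apply: aeS ae_interior => t h tI.
  have [t0 lt] := h tI; apply: lebesgue_pt_tent_eq => //.
  exact: H.
(* Without an interior Lebesgue point the segment itself is negligible, and 0 is a dummy
   constant. *)
exists 0; apply: aeS ae_interior => t h tI; exfalso.
by apply: noL; exists t; exact: h.
Qed.

End tent_average.

(** * Marginals *)

Lemma pushforward_probability d d' (X : measurableType d) (Y : measurableType d')
    (R : realType) (P : probability X R) (f : X -> Y) :
  measurable_fun setT f ->
  exists nu : probability Y R, forall B, nu B = pushforward P f B.
Proof.
move=> mf; pose F : {mfun X >-> Y} := HB.pack f (isMeasurableFun.Build _ _ _ _ f mf).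
by exists (distribution P F).
Qed.

Lemma continuous_borel (X Y : ptopologicalType) (f : X -> Y) : continuous f ->
  measurable_fun setT (f : borel X -> borel Y).
Proof.
move=> cf; apply: (@measurability _ _ (borel X) (borel Y) _ _ (@open Y)) => //.
move=> _ [U oU <-]; rewrite setTI; apply: sub_sigma_algebra.
by apply: open_comp => // x _; exact: cf.
Qed.

Section countable_pi_system.
Context (R : realType) (X : completeMetricType R).

(** Interiors of balls with dense centres and radii [1 / (k + 1)] form a countable base. Indexing
    their finite intersections by lists makes closure under intersection a concatenation and keeps
    the index type countable. *)
Lemma separable_pi_system : separable X ->
  exists U : seq (nat * nat) -> set X, [/\ forall s, open (U s),
    U [::] = setT, (forall s t, U s `&` U t = U (s ++ t)) &
    (@measurable _ (borel X)) = <<s range U >>].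
Proof.
move=> [D cD dD].
have [x0 [_ Dx0]] : setT `&` D !=set0.
  by apply: dD; [exists point|exact: openT].
have [f Df] : exists f : nat -> X, D `<=` range f.
  have /pfcard_geP[D0|[f]] := cD; first by move: Dx0; rewrite D0.
  by exists f => x /(@surj _ _ _ _ f)[n _ <-]; exists n.
pose V (p : nat * nat) := interior (ball (f p.1) (p.2.+1%:R^-1 : R)).
pose U s := foldr (fun p A => V p `&` A) setT s.
have oU s : open (U s).
  elim: s => [|p s IH]; first exact: openT.
  by apply: openI => //; exact: open_interior.
exists U; split => //.
  elim=> [|p s IH] t; first by rewrite /= setTI.
  by rewrite /= -setIA IH.
have sGsub : <<s range U >> `<=` <<s @open X >>.
  apply: smallest_sub; first exact: smallest_sigma_algebra.
  by move=> _ [s _ <-]; exact: sub_sigma_algebra.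
apply/seteqP; split; last exact: sGsub.
apply: smallest_sub; first exact: smallest_sigma_algebra.
move=> W oW.
have -> : W = \bigcup_(p : nat * nat) (if pselect (V p `<=` W) then V p else set0).
  apply/seteqP; split => [x Wx|x [p _]]; last first.
    by case: pselect => // h; exact: h.
  have /nbhs_ballP[e /= e0 eW] : nbhs x W by exact: open_nbhs_nbhs.
  (* With [r = 1 / (k + 1) < e / 2] and a dense point within [r / 2] of [x], the ball of radius [r]
     around that point contains a neighbourhood of [x] and lies in [ball x e]. *)
  have [k ke] : exists k : nat, k.+1%:R^-1 < e / 2.
    have e2 : 0 < e / 2 by rewrite divr_gt0.
    by have [k _ hk] := near_infty_natSinv_lt (PosNum e2); exists k; exact: (hk k (leqnn k)).
  have k0 : (0 : R) < k.+1%:R^-1 by rewrite invr_gt0.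
  have k20 : (0 : R) < k.+1%:R^-1 / 2 by rewrite divr_gt0.
  have [y [yi Dy]] : interior (ball x (k.+1%:R^-1 / 2 : R)) `&` D !=set0.
    apply: dD; last exact: open_interior.
    by exists x; exact: nbhsx_ballx.
  have [n _ fn] := Df _ Dy.
  have xy : ball x (k.+1%:R^-1 / 2) (f n) by rewrite fn; exact: interior_subset.
  exists (n, k) => //; case: pselect => [?|h] /=; last first.
    exfalso; apply: h => z /interior_subset zb; apply: eW.
    rewrite [e]splitr.
    apply: (@ball_triangle _ _ (f n)).
      by apply: le_ball xy; move: k0 ke; move: (_^-1) => r; lra.
    by apply: le_ball zb; exact: ltW.
  apply/nbhs_ballP; exists (k.+1%:R^-1 / 2) => //= z xz.
  rewrite [k.+1%:R^-1]splitr; apply: ball_triangle xz.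
  exact: ball_sym.
apply: (@countable_bigcupT_measurable _ (g_sigma_algebraType (range U))) => [|p].
  exact: countableP.
case: pselect => [?|?] /=; last exact: measurable0.
apply: sub_sigma_algebra; exists [:: p] => //=; by rewrite setIT.
Qed.

End countable_pi_system.

Section constant_marginal.
Context (R : realType) (Omega : completeMetricType R) (d : nat) (T : R).
Let state : ptopologicalType := (Omega * 'rV[R]_d)%type.

Lemma marginal_integral_ae_constant (v : R * Omega * 'rV[R]_d -> 'rV[R]_d)
    (mu : R -> probability (borel state) R) :
  Borel_curve T mu -> distributional_solution T v mu ->
  integrable_along T mu (fun t z => enorm (v (t, z.1, z.2)) / (1 + enorm z.2)) ->
  forall (psi : Omega -> R) (M : R), continuous psi -> (forall w, `|psi w| <= M) ->
  exists c : R, {ae lebesgue_measure, forall t : R, t \in `[0, T] ->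
    \int[mu t]_z psi z.1 = c}.
Proof.
move=> mmu sol growth psi M cpsi psiM.
have appr : approximable_opens R state.
  by move=> U oU; exact: (@open_indic_cvg R (Omega * 'rV[R]_d)%type U oU).
have cp : continuous (fun z : state => psi z.1).
  by move=> z; apply: (@cvg_comp _ _ _ fst psi); [exact: cvg_fst|exact: cpsi].
have pM (z : state) : `|psi z.1| <= M by [].
apply: (@ae_constant_of_tents _ _ _ M).
- exact: (Borel_curve_integral mmu cp pM).
- by move=> t; exact: normr_Rintegral_le.
move=> a b e e0 ae be.
(* Both steps equal 0 before the two tents and 1 after them, so their difference has compact support
   although neither step does. *)
pose eta t : R := step ((t - a) / e) - step ((t - b) / e).
have deta (t : R) : is_derive t 1 eta (scaled_tent a e t - scaled_tent b e t).
  by apply: is_deriveB; exact: is_derive_scaled_step.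
(* [M] may be 0, while [flux_eq0] asks for a positive bound. *)
have M1 w : `|psi w| <= M + 1 by rewrite (le_trans (psiM w))// lerDl.
have M10 : 0 < M + 1 by rewrite ltr_wpDl// (le_trans _ (psiM point)).
apply: (@flux_eq0 R Omega d T v mu mmu appr sol growth eta _
  (Num.min a b - e) (Num.max a b + e) 1 (e^-1)) M10 M1 => //.
- by move=> t; apply: cvgB; exact: continuous_scaled_tent.
- move=> t; have /andP[? ?] := step_bounds ((t - a) / e).
  have /andP[? ?] := step_bounds ((t - b) / e).
  by rewrite ler_norml; apply/andP; split; rewrite /eta; lra.
- move=> t; have /andP[? ?] := scaled_tent_bounds a t e0.
  have /andP[? ?] := scaled_tent_bounds b t e0.
  by rewrite ler_norml; apply/andP; split; lra.
move=> t; apply: contra_neqT; rewrite negb_and -!ltNge => /orP[|] h; rewrite /eta.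
  have [ta tb] : t < a - e /\ t < b - e.
    by move: h; rewrite ltrBrDr lt_min => /andP[? ?]; split; rewrite ltrBrDr.
  by rewrite !step_le ?subrr// ler_pdivrMr//; lra.
have [ta tb] : a + e < t /\ b + e < t.
  by move: h; rewrite -ltrBrDr gt_max => /andP[? ?]; split; rewrite -ltrBrDr.
by rewrite !step_ge ?subrr// ler_pdivlMr//; lra.
Qed.

End constant_marginal.

Theorem proposition4p2 (R : realType) (Omega : completeMetricType R)
    (sepOmega : separable Omega)
    (A : set (set Omega)) (sigmaA : sigma_algebra [set: Omega] A)
    (borelA : @open Omega `<=` A)
    (pi : probability (g_sigma_algebraType A) R)
    (completepi : measure_is_complete pi)
    (d : nat) (T : R) (T0 : 0 < T)
    (v : R * Omega * 'rV[R]_d -> 'rV[R]_d) (mv : Lebesgue_Borel T pi v)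
    (mu : R -> probability (borel (Omega * 'rV[R]_d)%type) R)
    (mmu : Borel_curve T mu)
    (solmu : distributional_solution T v mu)
    (growth : integrable_along T mu
       (fun t z => enorm (v (t, z.1, z.2)) / (1 + enorm z.2))) :
  exists nu : probability (borel Omega) R,
    {ae lebesgue_measure, forall t : R, t \in `[0, T] ->
      forall B : set (borel Omega), measurable B ->
        pushforward (mu t) (fst : borel (Omega * 'rV[R]_d)%type -> borel Omega) B
        = nu B}.
Proof.
have [U [oU U0 UI mU]] := separable_pi_system sepOmega.
have /choice[psi Hpsi] : forall s, exists f : nat -> Omega -> R,
    [/\ forall n, continuous (f n), forall n x, 0 <= f n x <= 1 &
    forall x, f n x @[n --> \oo] --> (\1_(U s) x : R)].
  by move=> s; exact: open_indic_cvg.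
have psi1 s n w : `|psi s n w| <= 1.
  by have [_ p01 _] := Hpsi s; have /andP[p0 p1] := p01 n w; rewrite ger0_norm.
have cpsi s n : continuous (psi s n) by have [] := Hpsi s.
have /choice[c Hc] : forall q : seq (nat * nat) * nat, exists c : R,
    {ae lebesgue_measure, forall t : R, t \in `[0, T] ->
      \int[mu t]_z psi q.1 q.2 z.1 = c}.
  by move=> q; exact: (marginal_integral_ae_constant mmu solmu growth (cpsi q.1 q.2) (psi1 q.1 q.2)).
(* The pairs [(s, n)] are enumerated by [pickle], so that a countable intersection gives one null
   set for all of them. *)
have aec : {ae lebesgue_measure, forall t : R, forall m : nat, t \in `[0, T] ->
    if unpickle m is Some q then \int[mu t]_z psi q.1 q.2 z.1 = c q else True}.
  apply: ae_foralln => m; case: unpickle => [q|]; first exact: Hc.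
  exact: aeW.
have {}aec : {ae lebesgue_measure, forall t : R, t \in `[0, T] ->
    forall s n, \int[mu t]_z psi s n z.1 = c (s, n)}.
  by apply: aeS aec => t h tI s n; have := h (pickle (s, n)) tI; rewrite pickleK.
(* The segment has measure [T > 0], so it contains a good time; the marginal at that time is the
   candidate [nu]. *)
have [t0 [t0I Ht0]] : exists t0, t0 \in `[0, T] /\
    forall s n, \int[mu t0]_z psi s n z.1 = c (s, n).
  apply: contrapT => no; have [N [mN N0 sN]] := aec.
  have : (lebesgue_measure (`[0%R, T]%classic : set R) <= lebesgue_measure N)%E.
    apply: le_measure; rewrite ?inE//.
    move=> t tI; apply: sN => /= h; apply: no; exists t; split => //; exact: h.
  by rewrite N0 lebesgue_measure_itv /= lte_fin T0 -EFinB subr0 lee_fin leNgt T0.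
have mfst : measurable_fun setT (fst : borel (Omega * 'rV[R]_d)%type -> borel Omega).
  by apply: (@continuous_borel (Omega * 'rV[R]_d)%type Omega) => z; exact: cvg_fst.
have [nu Hnu] := pushforward_probability (mu t0) mfst.
exists nu; apply: aeS aec => t Ht tI B mB.
have [nut Hnut] := pushforward_probability (mu t) mfst.
rewrite -Hnut; apply: (@measure_unique _ R (borel Omega) (range U) (fun=> setT)) => //.
- by move=> _ _ [s _ <-] [s' _ <-]; exists (s ++ s').
- by move=> _; exists [::].
- by apply/seteqP; split => // x _; exists 0%N.
- move=> _ [s _ <-]; apply: (etrans (Hnut (U s))); apply/esym.
  apply: (etrans (Hnu (U s))); rewrite /pushforward.
  have [cs s01 sU] := Hpsi s.
  have oUs : open (fst @^-1` U s : set (Omega * 'rV[R]_d)).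
    by apply: open_comp => // z _; exact: cvg_fst.
  (* At [t] and at [t0] the measures of [U s] are limits of the same constants [c (s, n)]. *)
  have lim r : (\int[mu r]_z psi s n z.1)%:E @[n --> \oo] --> mu r (fst @^-1` U s).
    apply: (@open_probability_cvg R (Omega * 'rV[R]_d)%type (mu r) _ (fun n z => psi s n z.1)) => //.
    by move=> n z; apply: (@cvg_comp _ _ _ fst (psi s n)); [exact: cvg_fst|exact: cs].
  apply: etrans (cvg_lim (@ereal_hausdorff R) (lim t)).
  apply: (etrans (esym (cvg_lim (@ereal_hausdorff R) (lim t0)))).
  by congr (limn _); apply/funext => n; rewrite Ht// Ht0.
- by move=> _; rewrite -ge0_fin_numE// (fin_num_measure nut).
Qed.
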